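(* Let $G$ be a connected $d$-regular graph on $n$ vertices, let $k$ be a positive integer with $k \equiv 2 \pmod 3$, and suppose $\operatorname{diam}(G) > k$. Then $$a(G^k) \geq \left(\frac{2k-1}{3}\right)(d+1) - \frac{(k-2)(k+1)(d+1)^2}{9n} - 1.$$
   Context: All graphs are finite, simple and connected. For a graph $G$ and a positive integer $k$, the $k$th power $G^k$ is the graph with vertex set $V(G)$ in which two distinct vertices are adjacent if and only if their distance in $G$ is at most $k$. $a(H)$ denotes the average degree of a graph $H$. $\operatorname{diam}(G)$ is the maximum distance between a pair of vertices of $G$. *)

(* Defs.v *)
From mathcomp Require Import all_boot all_order all_algebra.

Set Implicit Arguments.
Unset Strict Implicit.
Unset Printing Implicit Defensive.

Import Order.TTheory GRing.Theory Num.Theory.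

(* A finite simple graph is a symmetric irreflexive relation on a finType. *)
Definition simple_graph (T : finType) (e : rel T) : Prop :=
  symmetric e /\ irreflexive e.

Definition connected_graph (T : finType) (e : rel T) : Prop :=
  forall x y : T, connect e x y.

Definition walk_of_length (T : finType) (e : rel T) (x y : T) (m : nat) : bool :=
  [exists p : m.-tuple T, path e x p && (last x p == y)].

(* Two connected vertices are joined by a walk with fewer than #|T| edges, so
   searching the lengths 0, ..., #|T| - 1 finds the distance (see gdistP). The
   default value, when y is not reachable from x, is #|T|. *)
Definition gdist (T : finType) (e : rel T) (x y : T) : nat :=
  find (walk_of_length e x y) (iota 0 #|T|).

Definition diam (T : finType) (e : rel T) : nat :=
  \max_(x : T) \max_(y : T) gdist e x y.

Definition graph_power (T : finType) (e : rel T) (k : nat) : rel T :=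
  [rel x y | (x != y) && (gdist e x y <= k)].

Definition degree (T : finType) (e : rel T) (x : T) : nat :=
  #|[set y | e x y]|.

Definition regular (T : finType) (e : rel T) (d : nat) : Prop :=
  forall x : T, degree e x = d.

Definition avg_degree (T : finType) (e : rel T) : rat :=
  ((\sum_(x : T) degree e x)%N%:R / #|T|%:R)%R.

Lemma walk_of_lengthP (T : finType) (e : rel T) (x y : T) (m : nat) :
  reflect (exists p : seq T, [/\ size p = m, path e x p & last x p = y])
          (walk_of_length e x y m).
Proof.
apply: (iffP existsP) => [[p /andP[ep /eqP lp]]|[p [sp ep lp]]].
  by exists p; rewrite size_tuple.
by exists (Tuple (introT eqP sp)); rewrite /= ep lp eqxx.
Qed.

Lemma gdistP (T : finType) (e : rel T) (x y : T) : connect e x y ->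
  (exists p : seq T, [/\ size p = gdist e x y, path e x p & last x p = y]) /\
  (forall p : seq T, path e x p -> last x p = y -> gdist e x y <= size p).
Proof.
have short (p : seq T) : path e x p -> last x p = y ->
    exists2 m, m < #|T| & walk_of_length e x y m && (m <= size p).
  move=> ep lp; case: (shortenP ep) lp => q eq uq sub lq.
  exists (size q).
    by rewrite -[(size q).+1]/(size (x :: q)) -(card_uniqP uq) max_card.
  apply/andP; split; first by apply/walk_of_lengthP; exists q.
  by apply: uniq_leq_size (fun z => sub z); move: uq => /= /andP[].
have le_gdist m : m < #|T| -> walk_of_length e x y m -> gdist e x y <= m.
  move=> ltm wm; rewrite leqNgt; apply/negP => /(before_find 0).
  by rewrite nth_iota // add0n wm.
case/connectP=> p ep /esym lp; split; last first.
  move=> q eq lq; have [m ltm /andP[wm lem]] := short q eq lq.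
  exact: leq_trans (le_gdist m ltm wm) lem.
have [m ltm /andP[wm _]] := short p ep lp.
apply/walk_of_lengthP; rewrite /gdist.
have hasw : has (walk_of_length e x y) (iota 0 #|T|).
  by apply/hasP; exists m; rewrite // mem_iota.
have := nth_find 0 hasw; rewrite nth_iota ?add0n //.
by move: hasw; rewrite has_find size_iota.
Qed.

(* Main.v *)
Require Import Defs.
From mathcomp Require Import all_boot all_order all_algebra.
From mathcomp Require Import zify ring.

(** Write [k = 3m + 2] and [D = d + 1]; the claim is that the number of ordered
    pairs at distance at most [k] is at least [(2m+1) D n - m(m+1) D^2].
    Take a maximal set [S] of vertices at pairwise distance at least 3 that is
    connected through steps of length at most 3.  By maximality every vertex is
    within distance 2 of [S].  Growing [S] one vertex at a time, each new vertex
    sees at least [m] earlier ones within distance [3m], so [S] has at least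
    [(2m+1)|S| - m(m+1)] ordered pairs at distance at most [3m]; each of them
    gives [D^2] pairs at distance at most [3m+2] inside the union [U] of the
    closed neighbourhoods of [S].  A vertex [v] outside [U] has at least
    [(m+1) D] vertices in its [k]-ball, at least [m D] of which are in [U], so
    the pairs involving vertices outside [U] number at least [(2m+1) D] per such
    vertex. *)

Import Order.TTheory GRing.Theory Num.Theory.
Local Open Scope ring_scope.

Section ConnectedGraph.

Variables (T : finType) (e : rel T).
Hypotheses (sym_e : symmetric e) (irr_e : irreflexive e).
Hypothesis conn_e : connected_graph e.

Implicit Types (x y v s t : T) (S A : {set T}) (m j k : nat).

Local Notation dist := (gdist e).
Local Open Scope nat_scope.

(** * Distance as a metric, and sizes of balls *)

Lemma gdist_le_path x p : path e x p -> dist x (last x p) <= size p.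
Proof. by move=> ep; case: (gdistP (conn_e x (last x p))) => _; apply. Qed.

Lemma gdistxx x : dist x x = 0.
Proof. by have := @gdist_le_path x [::] isT; rewrite leqn0 => /eqP. Qed.

Lemma gdist_triangle y x z : dist x z <= dist x y + dist y z.
Proof.
have [[p [<- ep lp]] _] := gdistP (conn_e x y).
have [[q [<- eq lq]] _] := gdistP (conn_e y z).
rewrite -size_cat -lq -lp -last_cat; apply: gdist_le_path.
by rewrite cat_path ep lp.
Qed.

Lemma gdist_edge x y : e x y -> dist x y <= 1.
Proof. by move=> exy; apply: (@gdist_le_path x [:: y]); rewrite /= exy. Qed.

Lemma gdist_sym x y : dist x y = dist y x.
Proof.
suff le a b : dist b a <= dist a b by apply/eqP; rewrite eqn_leq !le.
have [[p [<- ep lp]] _] := gdistP (conn_e a b).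
have last_rev : last (last a p) (rev (belast a p)) = a.
  by case: (p) => //= u q; rewrite rev_cons last_rcons.
have := @gdist_le_path (last a p) (rev (belast a p)).
rewrite rev_path (eq_path (e' := e)) => [|u v]; last by rewrite sym_e.
by rewrite size_rev size_belast last_rev lp => /(_ ep).
Qed.

Definition ball k x := [set y | dist x y <= k].

Lemma card_ball1 x : #|ball 1 x| = (degree e x).+1.
Proof.
have -> : ball 1 x = x |: [set y | e x y].
  apply/setP => y; rewrite !inE; apply/idP/orP => [|[/eqP ->|]]; last first.
  - exact: gdist_edge.
  - by rewrite gdistxx.
  have [[p [<- ep <-]] _] := gdistP (conn_e x y).
  by case: p ep => [|u [|//]] /= => [_|/andP[exu _]] _; [left|right].
by rewrite cardsU1 inE irr_e.
Qed.

Lemma card_ballS k x : #|ball k x| = (degree (graph_power e k) x).+1.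
Proof.
have -> : ball k x = x |: [set y | graph_power e k x y].
  apply/setP => y; rewrite !inE /graph_power /=.
  by case: eqVneq => //= ->; rewrite gdistxx.
by rewrite cardsU1 !inE /graph_power /= eqxx.
Qed.

(** * Packings connected by steps of length at most three *)

Definition packing S :=
  {in S &, forall s t, dist s t <= 2 -> s = t}.

(** Connectedness of the graph joining members of [S] at distance at most 3, phrased through cuts so
    that no paths inside [S] are needed. *)
Definition linked S :=
  forall A, A != set0 -> A \proper S ->
  exists a b, [/\ a \in A, b \in S :\: A & dist a b <= 3].

Definition close m (S : {set T}) s := [set t in S | dist s t <= 3 * m].

Lemma linked1 x : linked [set x].
Proof.
move=> A nA; rewrite properEneq subset1 (negPf nA) orbF.
by case: eqVneq.
Qed.

(** A cut either separates [s] from [v], and is crossed by that pair, or restricts to a cut of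
    [S]. *)
Lemma linkedU1 S s v : s \in S -> dist s v <= 3 -> linked S -> linked (v |: S).
Proof.
move=> sS dsv lS A nA /properP[/subsetP AS [w wS wA]].
have vS' : v \in v |: S by rewrite !inE eqxx.
have [SA|] := boolP (S \subset A).
  exists s, v; split=> //; first exact: (subsetP SA).
  rewrite inE vS' andbT; move: wS; rewrite !inE => /orP[/eqP <- //|wS].
  by rewrite (subsetP SA) in wA.
move=> nSA; have [sA|nsA] := boolP (s \in A); last first.
  have [vA|nvA] := boolP (v \in A).
    by exists v, s; rewrite gdist_sym !inE nsA sS orbT vA.
  have AS' : A \proper S.
    rewrite properE nSA andbT; apply/subsetP => u uA.
    by have := AS u uA; rewrite !inE => /orP[/eqP uv|//]; rewrite -uv uA in nvA.
  have [a [b [aA]]] := lS A nA AS'; rewrite inE => /andP[bA bS] dab.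
  by exists a, b; rewrite !inE bA bS orbT.
have AS' : A :&: S \proper S.
  rewrite properE subsetIr; apply: contra nSA => /subsetP h.
  by apply/subsetP => u /h; rewrite inE => /andP[].
have nA' : A :&: S != set0 by apply/set0Pn; exists s; rewrite inE sA.
have [a [b []]] := lS _ nA' AS'; rewrite !inE => /andP[aA aS] /andP[bA bS] dab.
rewrite bS andbT in bA; exists a, b; split=> //.
by rewrite !inE bA bS orbT.
Qed.

(** While [close j S s] is not all of [S], a step of length at most 3 leaves it, so raising [j] by
    one gains a vertex. *)
Lemma linked_close S s j : linked S -> s \in S -> minn j.+1 #|S| <= #|close j S s|.
Proof.
move=> lS sS; elim: j => [|j IH].
  apply: leq_trans (geq_minl _ _) _; rewrite card_gt0; apply/set0Pn; exists s.
  by rewrite inE sS gdistxx.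
have sub : close j S s \subset close j.+1 S s.
  by apply/subsetP => t; rewrite !inE => /andP[-> ?]; lia.
have [eqS|neS] := eqVneq (close j S s) S.
  by move: (subset_leq_card sub); rewrite eqS; lia.
have pS : close j S s \proper S.
  by rewrite properEneq neS; apply/subsetP => t; rewrite inE => /andP[].
have n0 : close j S s != set0 by apply/set0Pn; exists s; rewrite inE sS gdistxx.
have [a [b []]] := lS _ n0 pS; rewrite !inE => /andP[aS da] /andP[nb bS] dab.
suff /proper_card : close j S s \proper close j.+1 S s by lia.
apply/properP; split=> //; exists b.
  by rewrite inE bS; have := gdist_triangle a s b; lia.
by rewrite inE.
Qed.

(** All pairs of so small an [S] are close; with [N = #|S|] the claim becomes
    [(N - m)(N - m - 1) >= 0], true for integers. *)
Lemma close_sum_lb m S : linked S -> #|S| <= m.+1 ->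
  (2 * m + 1) * #|S| <= \sum_(s in S) #|close m S s| + m * m.+1.
Proof.
move=> lS leS; have : \sum_(s in S) #|S| <= \sum_(s in S) #|close m S s|.
  by apply: leq_sum => s sS; have := linked_close S s m lS sS; lia.
rewrite sum_nat_const; suff : (2 * m + 1) * #|S| <= #|S| * #|S| + m * m.+1 by lia.
by move: (#|S|) leS => N leS; have [->|] := eqVneq N m.+1; nia.
Qed.

(* One step of the growth of S: the new vertex occurs in at least 2m+1 ordered
   pairs, itself included. *)
Lemma close_sumU1 m S v : v \notin S -> linked (v |: S) -> m < #|S| ->
  \sum_(s in S) #|close m S s| + (2 * m + 1) <=
  \sum_(s in v |: S) #|close m (v |: S) s|.
Proof.
move=> vS lS leS; rewrite big_setU1 //=.
have := linked_close _ v m lS (setU11 _ _); rewrite cardsU1 vS.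
have -> : close m (v |: S) v = v |: close m S v.
  by apply/setP => t; rewrite !inE; case: eqVneq => //= ->; rewrite gdistxx.
rewrite cardsU1 !inE (negPf vS) /= => cv.
have -> : \sum_(s in S) #|close m (v |: S) s| =
          \sum_(s in S) (#|close m S s| + (dist s v <= 3 * m)).
  apply: eq_bigr => s sS; have [d|d] := boolP (dist s v <= 3 * m).
    have -> : close m (v |: S) s = v |: close m S s.
      by apply/setP => t; rewrite !inE; case: eqVneq => //= ->; rewrite d.
    by rewrite cardsU1 inE (negPf vS) addnC.
  rewrite addn0; apply: eq_card => t; rewrite !inE.
  by case: eqVneq => //= ->; rewrite (negPf d) (negPf vS).
rewrite big_split /=.
(* By symmetry, each of the at least [m] old vertices close to [v] counts [v] in return: this is the
   second [m]. *)
have -> : \sum_(s in S) (dist s v <= 3 * m) = #|close m S v|.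
  rewrite -big_mkcondr /= sum1_card; apply: eq_card => t.
  by rewrite !inE gdist_sym.
lia.
Qed.

(** * Growing a dominating packing *)

Definition many_close m S :=
  (2 * m + 1) * #|S| <= \sum_(s in S) #|close m S s| + m * m.+1.

Definition dominating S := forall v, exists2 s, s \in S & dist s v <= 2.

(** If the set of vertices within 2 of [S] is not everything, connectivity gives an edge leaving it,
    whose outer end is at distance exactly 3 from [S]. *)
Lemma not_dominating S : S != set0 ->
  dominating S \/ exists v s, [/\ s \in S, dist s v <= 3 &
                                forall t, t \in S -> 2 < dist t v].
Proof.
case/set0Pn => s0 s0S.
pose A := [set v | [exists s in S, dist s v <= 2]].
have inA v : reflect (exists2 s, s \in S & dist s v <= 2) (v \in A).
  by rewrite inE; apply: (iffP exists_inP) => -[s]; exists s.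
have [/forallP cl|] := boolP [forall x, forall y, (x \in A) && e x y ==> (y \in A)].
  left=> v; apply/inA; have /connectP[p ep ->] := conn_e s0 v.
  have : s0 \in A by apply/inA; exists s0; rewrite ?gdistxx.
  elim: p s0 ep {s0S} => //= y p IH x /andP[exy ep] xA.
  by apply: IH => //; have /forallP/(_ y) := cl x; rewrite xA exy.
rewrite negb_forall => /existsP[x]; rewrite negb_forall => /existsP[y].
rewrite negb_imply => /andP[/andP[/inA[s sS dx] exy] yA]; right; exists y, s.
split=> // [|t tS].
  by have := gdist_triangle x s y; have := gdist_edge x y exy; lia.
by rewrite ltnNge; apply: contra yA => dty; apply/inA; exists t.
Qed.

Lemma exists_dominating_packing m x : exists S : {set T},
  [/\ x \in S, packing S, linked S, many_close m S & dominating S].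
Proof.
(* Induction on a bound [c] for the number of vertices outside [S]. *)
suff ext c S : #|T| <= #|S| + c -> x \in S -> packing S -> linked S ->
    many_close m S -> exists S : {set T},
    [/\ x \in S, packing S, linked S, many_close m S & dominating S].
  apply: (ext #|T| [set x]); rewrite ?leq_addl ?set11 //.
  - by move=> s t; rewrite !inE => /eqP -> /eqP ->.
  - exact: linked1.
  - by apply: close_sum_lb; [exact: linked1|rewrite cards1].
elim: c S => [|c IH] S leT xS pS lS mS;
    (case: (not_dominating S) => [||[v [s [sS dsv far]]]];
      [by apply/set0Pn; exists x|by exists S|]);
    have vS : v \notin S by (apply/negP => /far; rewrite gdistxx).
  have := max_card [pred z in v |: S]; rewrite cardsU1 vS.
  by move: leT; rewrite addn0 add1n => leT le; have := leq_trans le leT;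
    rewrite ltnn.
have lS' := linkedU1 S s v sS dsv lS.
apply: (IH (v |: S)) => //.
- by rewrite cardsU1 vS; lia.
- by rewrite !inE xS orbT.
- move=> a b; rewrite !inE => /orP[/eqP ->|aS] /orP[/eqP ->|bS] //.
  + by rewrite gdist_sym leqNgt far.
  + by rewrite leqNgt far.
  + exact: pS.
- rewrite /many_close; have [leS|ltS] := leqP #|v |: S| m.+1.
    exact: close_sum_lb.
  have mS' : m < #|S| by move: ltS; rewrite cardsU1 vS.
  have := close_sumU1 m S v vS lS' mS'.
  by move: mS; rewrite /many_close cardsU1 vS; lia.
Qed.

(** With at most [m] members, any two are within [3(m - 1)], so any two vertices of the graph are
    within [2 + 3(m - 1) + 2 = 3m + 1]. *)
Lemma dominating_linked_card m S : linked S -> dominating S ->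
  3 * m + 2 < diam e -> m < #|S|.
Proof.
move=> lS dS; apply: contraTltn => leS; rewrite -leqNgt.
apply/bigmax_leqP => x _; apply/bigmax_leqP => y _.
have [s sS dx] := dS x; have [t tS dy] := dS y.
have S_gt0 : 0 < #|S| by rewrite card_gt0; apply/set0Pn; exists s.
have : t \in close m.-1 S s.
  have := linked_close S s m.-1 lS sS; rewrite prednK; last by lia.
  rewrite (minn_idPr leS) => cS; suff -> : close m.-1 S s = S by [].
  apply/eqP; rewrite eqEcard cS andbT.
  by apply/subsetP => u; rewrite inE => /andP[].
rewrite inE => /andP[_ dst].
have := gdist_triangle s x y; have := gdist_triangle t s y.
by rewrite (gdist_sym x s); lia.
Qed.

(** * Counting pairs in a regular graph *)

Variable d : nat.
Hypothesis reg_e : regular e d.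

Definition closed_nbhd A := \bigcup_(s in A) ball 1 s.

(** Two balls of radius 1 that meet have centres within 2, so those around a packing are
    disjoint. *)
Lemma packing_sum S A (F : T -> nat) : packing S -> A \subset S ->
  \sum_(v in closed_nbhd A) F v = \sum_(s in A) \sum_(v in ball 1 s) F v.
Proof.
move=> pS /subsetP AS; rewrite [closed_nbhd A]big_mkcond.
rewrite partition_disjoint_bigcup.
  rewrite [RHS]big_mkcond; apply: eq_bigr => s _.
  by case: ifP => // _; rewrite big_set0.
move=> s t nst; case: ifP => [sA|_]; last by rewrite disjoints_subset sub0set.
case: ifP => [tA|_]; last by rewrite disjoint_sym disjoints_subset sub0set.
rewrite -setI_eq0; apply/eqP/setP => v; rewrite !inE.
apply: contraNF nst => /andP[ds dt]; apply/eqP; apply: pS; rewrite ?AS //.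
by have := gdist_triangle v s t; rewrite (gdist_sym v t); lia.
Qed.

Lemma card_closed_nbhd S A : packing S -> A \subset S -> #|closed_nbhd A| = d.+1 * #|A|.
Proof.
move=> pS AS; rewrite -sum1_card (packing_sum S) //.
rewrite (eq_bigr (fun=> d.+1)) ?sum_nat_const 1?mulnC // => s _.
by rewrite sum1_card card_ball1 reg_e.
Qed.

(** Used with [(c, j)] equal to [(0, m)], [(1, m)] and [(2, m - 1)], according to how far [v] is
    from the packing. *)
Lemma ball_closed_nbhd_close j k c S v s : packing S -> dist v s <= c ->
  c + 3 * j + 1 <= k -> d.+1 * #|close j S s| <= #|ball k v :&: closed_nbhd S|.
Proof.
move=> pS dv le_k; have sub : close j S s \subset S.
  by apply/subsetP => t; rewrite inE => /andP[].
rewrite -(card_closed_nbhd S) //; apply/subset_leq_card/subsetP => w.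
case/bigcupP => t; rewrite inE => /andP[tS dst]; rewrite inE => dw.
rewrite inE; apply/andP; split; last by apply/bigcupP; exists t; rewrite ?inE.
by rewrite inE; have := gdist_triangle s v w; have := gdist_triangle t s w; lia.
Qed.

(** The packing is grown from [v] itself: a detour of 2 to reach it would already exceed the radius
    [3m + 2]. *)
Lemma card_ball_lb m v : 3 * m + 2 < diam e -> d.+1 * m.+1 <= #|ball (3 * m + 2) v|.
Proof.
move=> ltd; have [S [vS pS lS _ dS]] := exists_dominating_packing m v.
have := ball_closed_nbhd_close m (3 * m + 2) 0 S v v pS; rewrite gdistxx => /(_ isT).
have := dominating_linked_card m S lS dS ltd; have := linked_close S v m lS vS.
have := subset_leq_card (subsetIl (ball (3 * m + 2) v) (closed_nbhd S)).
move=> h1 h2 h3 /(_ ltac:(lia)) h4.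
apply: leq_trans h1; apply: leq_trans h4; rewrite leq_pmul2l //; lia.
Qed.

(** Pairs from [U] to its complement are charged to their outer end, so [ball k v :&: U] counts
    twice for [v] outside [U]. *)
Lemma sum_card_ball_split k (U : {set T}) :
  \sum_v #|ball k v| = \sum_(v in U) #|ball k v :&: U|
    + \sum_(v in ~: U) (#|ball k v| + #|ball k v :&: U|).
Proof.
rewrite (bigID (mem U)) /=.
rewrite [X in X + _](eq_bigr (fun v => #|ball k v :&: U| + #|ball k v :\: U|));
  last by move=> v _; rewrite cardsID.
rewrite big_split -addnA; congr (_ + _).
rewrite [in RHS]big_split /= addnC; congr (_ + _).
  by apply: eq_bigl => v; rewrite !inE.
have cardE (A B : {set T}) : #|A :&: B| = \sum_(w in B) (w \in A).
  rewrite -big_mkcondr /= sum1_card; apply: eq_card => w.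
  by rewrite !inE andbC.
under eq_bigr do rewrite setDE cardE.
rewrite exchange_big /=; apply: eq_bigr => v _; rewrite cardE.
by apply: eq_bigr => w _; rewrite !inE gdist_sym.
Qed.

Lemma sum_card_ball_lb m : 3 * m + 2 < diam e ->
  (2 * m + 1) * d.+1 * #|T| <=
  \sum_v #|ball (3 * m + 2) v| + m * m.+1 * d.+1 ^ 2.
Proof.
move=> ltd; have [/card0_eq T0|/card_gt0P[x _]] := posnP #|T|.
  by rewrite (eq_card0 T0) muln0.
have [S [xS pS lS mS dS]] := exists_dominating_packing m x.
have ltS := dominating_linked_card m S lS dS ltd.
set k := 3 * m + 2; pose U := closed_nbhd S.
have sumU : d.+1 ^ 2 * \sum_(s in S) #|close m S s|
            <= \sum_(v in U) #|ball k v :&: U|.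
  rewrite (packing_sum S) // big_distrr; apply: leq_sum => s sS /=.
  rewrite -mulnA -{1}(reg_e s) -card_ball1 -sum_nat_const; apply: leq_sum => v.
  rewrite inE gdist_sym => dv; apply: (ball_closed_nbhd_close m k 1) => //.
  by rewrite /k; lia.
have sumR : (2 * m + 1) * d.+1 * #|~: U|
            <= \sum_(v in ~: U) (#|ball k v| + #|ball k v :&: U|).
  rewrite mulnC -sum_nat_const; apply: leq_sum => v _.
  have [s sS dv] := dS v; have := card_ball_lb m v ltd; rewrite -/k.
  suff : d.+1 * m <= #|ball k v :&: U| by nia.
  (* Reaching [S] may cost 2, which leaves only [m - 1] linking steps, hence [m] members of [S]. *)
  have [->|m_gt0] := posnP m; first by rewrite muln0.
  rewrite gdist_sym in dv.
  have := ball_closed_nbhd_close m.-1 k 2 S v s pS dv ltac:(rewrite /k; lia).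
  apply: leq_trans; rewrite leq_pmul2l //.
  by have := linked_close S s m.-1 lS sS; rewrite prednK // ; lia.
have := cardsC U; rewrite (card_closed_nbhd S) // => <-.
rewrite (sum_card_ball_split k U).
have : d.+1 ^ 2 * ((2 * m + 1) * #|S|) <=
       d.+1 ^ 2 * (\sum_(s in S) #|close m S s| + m * m.+1).
  by rewrite leq_pmul2l ?expn_gt0.
by nia.
Qed.

End ConnectedGraph.

Theorem theorem1p2 (T : finType) (e : rel T) (n d k : nat)
  (graph_e : simple_graph e)
  (conn_e : connected_graph e)
  (reg_e : regular e d)
  (card_T : #|T| = n)
  (k_gt0 : (0 < k)%N)
  (k_mod3 : k = 2 %[mod 3])
  (diam_gt : (k < diam e)%N) :
  avg_degree (graph_power e k) >=
    (2 * k%:R - 1) / 3 * (d%:R + 1)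
    - (k%:R - 2) * (k%:R + 1) * (d%:R + 1) ^+ 2 / (9 * n%:R) - 1.
Proof.
have [sym_e irr_e] := graph_e.
have [m def_k] : exists m, k = (3 * m + 2)%N by exists (k %/ 3)%N; lia.
have n_gt0 : (0 < n)%N.
  rewrite -card_T lt0n; apply: contraTneq diam_gt => T0.
  rewrite -leqNgt; apply/bigmax_leqP => x _.
  by have := card0_eq T0 x.
rewrite {}def_k in diam_gt *.
have := sum_card_ball_lb T e sym_e irr_e conn_e d reg_e m diam_gt.
(* Balls contain their centre; removing it from each gives the final [- 1] of the bound. *)
under eq_bigr do rewrite (card_ballS T e conn_e) -addn1.
rewrite big_split /= sum1_card card_T /avg_degree card_T.
set F := (\sum_x _)%N; rewrite -(ler_nat rat) => le.
have n0 : (0 : rat) < n%:R by rewrite ltr0n.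
(* For [k = 3m + 2], [(2k - 1)/3 = 2m + 1] and [(k - 2)(k + 1)/9 = m(m + 1)], so after multiplying
   by [n] both inequalities have the same difference of sides. *)
rewrite ler_pdivlMr // -subr_ge0.
move: le; rewrite -subr_ge0; congr (0 <= _).
rewrite !(natrD, natrM, natrX, natr1, mulrS); field.
by rewrite gt_eqF.
Qed.
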